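(* Let $f\colon X\rightharpoonup X$ be a partial map on a metric space $(X,d)$, let $a<b$ be non-negative integers, and let $F\colon D_F\rightharpoonup D_F$ be the restriction of the time extension of $f$ to $D_F\subseteq \{a,a+1,\dots,b\}\times X$, where $D_F$ is equipped with the cost function $c_d$ associated with $d$. Let $G,B \subset \{b \} \times X = D_{F} - \operatorname{dom}F$ be subsets with $G \sqcup B = \{b \} \times X$ (disjoint union). The following statements hold: (1) If there is a point $(b-n,x) \in \operatorname{dom}F$ with $F^n(b-n,x)\in G$ for some positive integer $n$, then $D_F - B = \bigcup_{\varepsilon \in \mathbb{R}} G_{F,\varepsilon_{\Sigma}} = \bigcup_{\varepsilon \in \mathbb{R}} G_{F,\varepsilon}$. (2) If there is a point $(b-n,x) \in \operatorname{dom}F$ with $F^n(b-n,x)\in B$ for some positive integer $n$, then $D_F - G = \bigcup_{\varepsilon \in \mathbb{R}} B_{F,\varepsilon_{\Sigma}} = \bigcup_{\varepsilon \in \mathbb{R}} B_{F,\varepsilon}$.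
   Context: A partial map $f\colon X\rightharpoonup X$ is a map from a subset $\operatorname{dom}f\subseteq X$ to $X$. Time extension: put $Y:=\{a,a+1,\dots,b\}\times X$ and let $\widetilde f\colon Y\rightharpoonup Y$, $\widetilde f(t,x):=(t+1,f(x))$, be defined for $t\le b-1$ and $x\in\operatorname{dom}f$. Let $D_F:=\{(b-n,x)\in Y\mid n\in\{0,1,\dots,b-a\},\ f^n(x)\text{ is defined (i.e. } f^n(x)\in X)\}$ and let $F:=\widetilde f|_{D_F}\colon D_F\rightharpoonup D_F$. Then $\operatorname{dom}F=D_F-(\{b\}\times X)$, so $D_F-\operatorname{dom}F=\{b\}\times X$. Cost function associated with $d$: $c_d\colon D_F\times D_F\to[0,\infty]$, $c_d((t,x),(t',x')):=d(x,x')$ if $t=t'$ and $:=\infty$ if $t\ne t'$. Reachable sets (with $c=c_d$): let $\varepsilon\in[0,\infty]$ and $y\in D_F$. The set $[y]_F^{\varepsilon}$ consists of $y$ itself (path of length $0$) together with all points of the form $F(y_{n-1})$, where $n\ge 1$ and $(y_0,\dots,y_{n-1})\in(\operatorname{dom}F)^n$ satisfies $c(y,y_0)\le\varepsilon$ and $c(F(y_i),y_{i+1})\le\varepsilon$ for all $0\le i\le n-2$. The set $[y]_F^{\varepsilon_\Sigma}$ consists of $y$ itself together with all points of the form $F(y_{n-1})$, where $n\ge1$, $(y_0,\dots,y_{n-1})\in(\operatorname{dom}F)^n$, and there is $(\varepsilon_0,\dots,\varepsilon_{n-1})\in[0,\infty]^n$ with $\sum_{i=0}^{n-1}\varepsilon_i\le\varepsilon$,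 $c(y,y_0)\le\varepsilon_0$ and $c(F(y_i),y_{i+1})\le\varepsilon_{i+1}$ for all $0\le i\le n-2$. Attracting basins of $A\subseteq D_F$: for $\varepsilon\in[0,\infty]$, $A_{F,\varepsilon}:=\{y\in D_F\mid [y]_F^{\varepsilon}\cap A\ne\emptyset\}$; $A_{F,-0}:=\{y\in D_F\mid \emptyset\ne[y]_F^{0}\setminus\operatorname{dom}F\subseteq A\}$; and for $\varepsilon\in(0,\infty]$, $A_{F,-\varepsilon}:=\{y\in A_{F,-0}\mid\emptyset\ne[y]_F^{\varepsilon}\setminus\operatorname{dom}F\subseteq A\}$. The sets $A_{F,\varepsilon_\Sigma}$, $A_{F,-0_\Sigma}$, $A_{F,-\varepsilon_\Sigma}$ are defined in the same way with $[y]_F^{\varepsilon_\Sigma}$, $[y]_F^{0_\Sigma}$ in place of $[y]_F^{\varepsilon}$, $[y]_F^{0}$. In a family indexed by $\varepsilon\in\mathbb{R}$, the member of index $0$ is $A_{F,0}$ (resp. $A_{F,0_\Sigma}$), and the member of negative index $-\varepsilon$ ($\varepsilon>0$) is $A_{F,-\varepsilon}$ (resp. $A_{F,-\varepsilon_\Sigma}$). *)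

(* Defs.v *)
From HB Require Import structures.
From mathcomp Require Import all_boot all_order all_algebra.
From mathcomp Require Import boolp classical_sets reals constructive_ereal topology.

Set Implicit Arguments.
Unset Strict Implicit.
Unset Printing Implicit Defensive.

Import Order.TTheory GRing.Theory Num.Theory.

Local Open Scope classical_set_scope.
Local Open Scope ereal_scope.

Section PartialMaps.
Context {T : Type}.
Implicit Type g : T -> option T.

Definition pdom g : set T := [set x | g x].

Definition piter g (n : nat) (x : T) : option T := iter n (obind g) (Some x).

(* The value is undefined where [g] leaves [D]; see [time_restrE] below for the
   case of interest, where this does not happen. *)
Definition prestrict g (D : set T) : D -> option D :=
  fun y => obind insub (g (val y)).

End PartialMaps.

Section TimeExtension.
Context {X : Type} (a b : nat) (f : X -> option X).

Definition time_space : set (nat * X) := [set y | (a <= y.1 <= b)%N].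

Definition time_ext (y : nat * X) : option (nat * X) :=
  if (a <= y.1 < b)%N then omap (pair y.1.+1) (f y.2) else None.

Definition time_dom : set (nat * X) :=
  time_space `&` [set y | exists n x,
    [/\ (n <= b - a)%N, piter f n x & y = ((b - n)%N, x)]].

Definition time_restr : time_dom -> option time_dom :=
  prestrict time_ext (D := time_dom).

Definition final_slice : set time_dom := [set y | (val y).1 = b].

Lemma time_restrE (y : time_dom) : omap val (time_restr y) = time_ext (val y).
Proof.
rewrite /time_restr /prestrict.
case E : (time_ext (val y)) => [z|//] /=.
suff zD : z \in time_dom by rewrite insubT.
move: E; case: y => -[t x] /= yD; rewrite /time_ext /=.
case: ifP => // /andP[at_ tb]; case fx : (f x) => [x'|//] /= [<-].
move: (yD) => /set_mem[_ /= [n [x0 [nba fn [tE xE]]]]]; subst x0.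
apply/mem_set; split; first by rewrite /time_space /= tb (leq_trans at_).
case: n nba fn tE => [|n] nba fn tE; first by rewrite tE subn0 ltnn in tb.
exists n, x'; split; first exact: ltnW.
- by move: fn; rewrite /piter iterSr /= fx.
- by rewrite tE subnSK// (leq_trans nba)// leq_subr.
Qed.

Lemma setC_pdom_time_restr : ~` pdom time_restr = final_slice.
Proof.
have H (y : time_dom) : time_restr y = time_ext (val y) :> bool.
  by rewrite -time_restrE; case: time_restr.
apply/seteqP; split=> y; rewrite /pdom /final_slice /= H;
  case: y => -[t x] yD; rewrite /time_ext /=; last first.
  by move=> ->; rewrite ltnn andbF.
move: (yD) => /set_mem[/andP[/= at_ tb] [n [x0 [nba fn [tE xE]]]]]; subst x0.
case: n nba fn tE => [|n] nba fn tE; first by rewrite tE subn0.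
have fx : f x.
  move: fn; rewrite /piter iterSr /=; case: (f x) => //.
  by have -> : iter n (obind f) None = None by elim: n {nba tE} => //= n ->.
case: ltnP => [_|bt _]; last by apply/eqP; rewrite eqn_leq tb.
by rewrite at_; case: (f x) fx.
Qed.

End TimeExtension.

Arguments time_restr {X} a b f _.
Arguments final_slice {X} a b f _.

Definition time_cost {R : realType} {X : metricType R} (a b : nat)
    (f : X -> option X) (y z : time_dom a b f) : \bar R :=
  if (val y).1 == (val z).1 then (mdist (val y).2 (val z).2)%:E else +oo.

Arguments time_cost {R X} a b f _ _.

(* In this section [p] lists y_0, .., y_{n-1} and [q] lists their images
   F(y_0), .., F(y_{n-1}); values of [p], [q], [s] beyond n-1 are irrelevant. *)
Section ReachableSets.
Context {R : realType} {Y : Type} (F : Y -> option Y) (c : Y -> Y -> \bar R).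

Definition reach (e : \bar R) (y : Y) : set Y :=
  [set z | z = y \/ exists (n : nat) (p q : nat -> Y),
    [/\ (0 < n)%N,
        forall i, (i < n)%N -> F (p i) = Some (q i),
        c y (p 0%N) <= e,
        forall i, (i.+1 < n)%N -> c (q i) (p i.+1) <= e
      & z = q n.-1]].

Definition reach_sum (e : \bar R) (y : Y) : set Y :=
  [set z | z = y \/ exists (n : nat) (p q : nat -> Y) (s : nat -> \bar R),
    [/\ (0 < n)%N /\ (forall i, (i < n)%N -> F (p i) = Some (q i)),
        (forall i, (i < n)%N -> 0 <= s i) /\ \sum_(i < n) s i <= e,
        c y (p 0%N) <= s 0%N,
        forall i, (i.+1 < n)%N -> c (q i) (p i.+1) <= s i.+1
      & z = q n.-1]].

End ReachableSets.

(* [r] is the family of reachable sets: [reach F c] or [reach_sum F c]. *)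
Section Basins.
Context {R : realType} {Y : Type} (F : Y -> option Y) (r : \bar R -> Y -> set Y).
Implicit Type A : set Y.

Definition pos_basin A (e : \bar R) : set Y := [set y | r e y `&` A !=set0].

Definition neg_basin0 A : set Y :=
  [set y | r 0 y `\` pdom F !=set0 /\ r 0 y `\` pdom F `<=` A].

Definition neg_basin A (e : \bar R) : set Y :=
  neg_basin0 A `&`
  [set y | r e y `\` pdom F !=set0 /\ r e y `\` pdom F `<=` A].

Definition basin A (e : R) : set Y :=
  if (0 <= e)%R then pos_basin A e%:E else neg_basin A (- e)%:E.

End Basins.

(* Main.v *)
(* Choose y0 with F y0 in G; it lies on the time slice just before b.  Any point
   outside the last slice can follow its own orbit to that slice and then make a
   single jump, of finite cost, to y0.  Conversely a point of B lies on the last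
   slice, whence every jump of finite cost stays on it, outside dom F. *)
Require Import Defs.
From HB Require Import structures.
From mathcomp Require Import all_boot all_order all_algebra.
From mathcomp Require Import boolp classical_sets reals constructive_ereal topology.

Import Order.TTheory GRing.Theory Num.Theory.

Local Open Scope classical_set_scope.

(** The same path serves: its allowances are nonnegative, so each is at most their sum, hence at
    most [e]. *)
Lemma sub_reach_sum_reach {R : realType} {Y : Type} (F : Y -> option Y)
    (c : Y -> Y -> \bar R) (e : \bar R) (y : Y) :
  reach_sum F c e y `<=` reach F c e y.
Proof.
move=> z [->|[n [p [q [s [[n0 pq] [s0 se] c0 cS ->]]]]]]; first by left.
have s_le i : (i < n)%N -> (s i <= e)%E.
  move=> ni; apply: le_trans se; rewrite (bigD1 (Ordinal ni))//= leeDl//.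
  by apply: sume_ge0 => j _; apply: s0.
right; exists n, p, q; split => //; first exact: le_trans c0 (s_le _ n0).
by move=> i ni; apply: le_trans (cS _ ni) (s_le _ ni).
Qed.

Section TimeRestriction.
Context {R : realType} {X : metricType R} (a b : nat) (f : X -> option X).

Let F := time_restr a b f.
Let c := time_cost a b f.
Let time (y : time_dom a b f) : nat := (val y).1.

Lemma time_restr_time (y z : time_dom a b f) :
  F y = Some z -> time z = (time y).+1.
Proof.
move=> Fy; have := time_restrE y; rewrite -/F Fy /= /time_ext.
by case: ifP => // _; case: (f _) => // x [zE]; rewrite /time /= zE.
Qed.

Lemma time_le (y : time_dom a b f) : (time y <= b)%N.
Proof. by rewrite /time; case: y => y /= /set_mem[/andP[]]. Qed.

Lemma time_cost_self (y : time_dom a b f) : c y y = 0%E.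
Proof. by rewrite /c /time_cost eqxx mdistxx. Qed.

Lemma time_cost_fin (y z : time_dom a b f) (e : R) :
  (c y z <= e%:E)%E -> time y = time z.
Proof. by rewrite /c /time_cost; case: eqP. Qed.

Lemma reach_final_slice (y : time_dom a b f) (e : R) :
  final_slice a b f y -> reach F c e%:E y `<=` [set y].
Proof.
move=> yb z [//|[n [p [q [n0 pq /time_cost_fin yp _ _]]]]].
(* A path of positive length would put [p 0] at time [b], hence [q 0] at time [b + 1]. *)
have := time_le (q 0%N).
by rewrite (time_restr_time _ _ (pq _ n0)) -yp /time yb ltnn.
Qed.

(** A total version of [F], so that orbits can be iterated; the default value occurs only on the
    final slice, where no step is taken below. *)
Let step (y : time_dom a b f) := odflt y (F y).

Lemma time_restr_step (y : time_dom a b f) :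
  (time y < b)%N -> F y = Some (step y).
Proof.
move=> yb; rewrite /step; case Fy : (F y) => //=.
have : final_slice a b f y by rewrite -setC_pdom_time_restr /pdom /= -/F Fy.
by rewrite /final_slice /= => yE; rewrite /time yE ltnn in yb.
Qed.

Lemma time_iter_step (y : time_dom a b f) (i : nat) :
  (time y + i <= b)%N -> time (iter i step y) = (time y + i)%N.
Proof.
elim: i => [|i IH] yi; first by rewrite addn0.
have {}IH := IH (leq_trans (leq_add (leqnn _) (leqnSn i)) yi).
rewrite addnS in yi *; rewrite iterS (time_restr_time (iter i step y)) ?IH//.
by apply: time_restr_step; rewrite IH.
Qed.

Lemma reach_sum_final (y y0 z : time_dom a b f) :
  (time y < b)%N -> F y0 = Some z -> final_slice a b f z ->
  exists2 e : R, (0 <= e)%R & reach_sum F c e%:E y z.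
Proof.
(* [m] steps bring [y] to time [b - 1], which is also the time of [y0] since [F y0 = Some z]. *)
move=> yb Fy0 zb; pose m := (b - (time y).+1)%N.
have ymb : (time y + m).+1 = b by rewrite -addSn subnKC.
have y0m : time (iter m step y) = time y0.
  apply: succn_inj; rewrite -(time_restr_time _ _ Fy0) time_iter_step.
    by rewrite ymb; apply/esym.
  by rewrite -ymb.
pose d : R := mdist (val (iter m step y)).2 (val y0).2.
(* The orbit of [y] costs nothing up to index [m]; there the jump to [y0] spends the whole budget
   [d]. *)
pose p i := if (i < m)%N then iter i step y else y0.
pose q i := if (i < m)%N then iter i.+1 step y else z.
pose s i : \bar R := if (i < m)%N then 0%E else d%:E.
(* This covers both the initial jump ([i = 0]) and the later ones, as [q i] is [iter i.+1 step y]
   for [i < m]. *)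
have cs i : (i <= m)%N -> (c (iter i step y) (p i) <= s i)%E.
  rewrite /p /s; case: ltnP => [_ _|mi im]; first by rewrite time_cost_self.
  have -> : i = m by apply/eqP; rewrite eqn_leq im.
  by rewrite /c /time_cost -/(time _) -/(time y0) y0m eqxx.
exists d; first exact: mdist_ge0.
right; exists m.+1, p, q, s; split.
- split=> // i _; rewrite /p /q; case: ltnP => // im.
  have yib : (time y + i < b)%N by rewrite -ymb ltnS leq_add2l ltnW.
  by rewrite time_restr_step// time_iter_step// ltnW.
- split=> [i _|]; first by rewrite /s; case: ifP; rewrite ?lee_fin ?mdist_ge0.
  rewrite big_ord_recr big1/= => [|i _]; last by rewrite /s ltn_ord.
  by rewrite add0e /s ltnn.
- exact: (cs 0%N).
- by move=> i im; rewrite /q -ltnS im; apply: cs.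
- by rewrite /q /= ltnn.
Qed.

(** Sandwiching [r] between [reach_sum] and [reach] treats both families of basins at once: paths
    are built in the smaller set and excluded in the larger one. *)
Lemma setC_bigcup_basin (r : \bar R -> time_dom a b f -> set (time_dom a b f))
    (G B : set (time_dom a b f)) (y0 z : time_dom a b f) :
  (forall e y, reach_sum F c e y `<=` r e y) ->
  (forall e y, r e y `<=` reach F c e y) ->
  G `|` B = final_slice a b f -> G `&` B = set0 ->
  F y0 = Some z -> G z ->
  ~` B = \bigcup_(e in [set: R]) basin F r G e.
Proof.
move=> sumr rreach GB disj Fy0 Gz.
have rself e y : r e y y by apply: sumr; left.
have Gb y : G y -> final_slice a b f y by rewrite -GB; left.
apply/seteqP; split=> [y By|y [e _ Ge] By].
  have [yb|by_] := ltnP (time y) b.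
    have [e e0 yz] := reach_sum_final y y0 z yb Fy0 (Gb _ Gz).
    by exists e => //; rewrite /basin e0; exists z; split=> //; apply: sumr.
  (* At time [b], a point outside [B] is in [G], and the path of length 0 gives index 0. *)
  have [Gy|//] : (G `|` B) y.
    by rewrite GB; apply/eqP; rewrite eqn_leq by_ time_le.
  by exists 0%R => //; rewrite /basin lexx; exists y.
have yb : final_slice a b f y by rewrite -GB; right.
suff Gy : G y by rewrite -[False]/(set0 y) -disj.
move: Ge; rewrite /basin; case: ifP => _.
  (* Nonnegative index: the point of [G] reached from [y] can only be [y]. *)
  by move=> [w [/rreach /(reach_final_slice _ _ yb) ->]].
(* Negative index: [y] reaches itself and lies outside [pdom F], so the index-0 condition already
   puts it in [G]. *)
move=> [[_ rG] _]; apply: rG; split; first exact: rself.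
by move: yb; rewrite -setC_pdom_time_restr.
Qed.

Lemma bigcup_basin_reach (G B : set (time_dom a b f)) (n : nat)
    (y z : time_dom a b f) :
  G `|` B = final_slice a b f -> G `&` B = set0 ->
  (0 < n)%N -> piter F n y = Some z -> G z ->
  ~` B = \bigcup_(e in [set: R]) basin F (reach_sum F c) G e /\
  \bigcup_(e in [set: R]) basin F (reach_sum F c) G e =
    \bigcup_(e in [set: R]) basin F (reach F c) G e.
Proof.
case: n => // n GB disj _ Fnz Gz.
(* Only the last step of the orbit into [G] matters. *)
have [y0 Fy0] : exists y0, F y0 = Some z.
  by move: Fnz; rewrite /piter iterS; case: (iter n _ _) => //= y0; exists y0.
have sumE : ~` B = \bigcup_(e in [set: R]) basin F (reach_sum F c) G e.
  apply: (setC_bigcup_basin _ G B y0 z) => // e w; first exact: subset_refl.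
  exact: sub_reach_sum_reach.
split=> //; rewrite -sumE.
apply: (setC_bigcup_basin _ G B y0 z) => // e w; last exact: subset_refl.
exact: sub_reach_sum_reach.
Qed.

End TimeRestriction.

Theorem theorem3p5 (R : realType) (X : metricType R) (f : X -> option X)
    (a b : nat) (hab : (a < b)%N) (G B : set (time_dom a b f))
    (hGB : G `|` B = final_slice a b f) (hdisj : G `&` B = set0) :
  let F := time_restr a b f in
  let c := time_cost a b f in
  ((exists (n : nat) (x : X) (y z : time_dom a b f),
      [/\ (0 < n <= b)%N, val y = ((b - n)%N, x), pdom F y,
          piter F n y = Some z & G z]) ->
    ~` B = \bigcup_(e in [set: R]) basin F (reach_sum F c) G e /\
    \bigcup_(e in [set: R]) basin F (reach_sum F c) G e =
      \bigcup_(e in [set: R]) basin F (reach F c) G e) /\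
  ((exists (n : nat) (x : X) (y z : time_dom a b f),
      [/\ (0 < n <= b)%N, val y = ((b - n)%N, x), pdom F y,
          piter F n y = Some z & B z]) ->
    ~` G = \bigcup_(e in [set: R]) basin F (reach_sum F c) B e /\
    \bigcup_(e in [set: R]) basin F (reach_sum F c) B e =
      \bigcup_(e in [set: R]) basin F (reach F c) B e).
Proof.
move=> F c; split=> -[n [x [y [z [/andP[n0 _] _ _ Fnz Az]]]]].
  exact: (bigcup_basin_reach _ _ _ _ _ n y z).
(* The hypotheses on [G] and [B] are symmetric, so the roles can be swapped. *)
by apply: (bigcup_basin_reach _ _ _ _ _ n y z); rewrite // 1?setUC 1?setIC.
Qed.
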